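(* Let $(A,\circ)$ be a Novikov algebra and $r\in A\otimes A$. (i) $r$ is a solution of the Novikov Yang-Baxter equation $r_{13}\circ r_{23}+r_{12}\star r_{23}+r_{13}\circ r_{12}=0$ in $A$ if and only if $$\hat r(a^* )\circ\hat r(b^* )=\hat r\Big(L_{A,\star}^*(\hat r(a^* ))b^*-(-R_A)^*(\hat r^t(b^* ))a^*\Big),\qquad a^*,b^*\in A^*.$$ (ii) Let $\hat r=\alpha+\beta$ with $\alpha=(\hat r-\hat r^t)/2$ and $\beta=(\hat r+\hat r^t)/2$, and let $\kappa\in\mathbf k$. Assume that the symmetric part $\check\beta=(r+\tau r)/2$ of $r$ is invariant. Then $r$ is a solution of $$r_{13}\circ r_{23}+r_{12}\star r_{23}+r_{13}\circ r_{12}=\frac{\kappa+1}{4}\,(r_{13}+(\tau r)_{13})\circ(r_{23}+(\tau r)_{23})$$ if and only if $\alpha$ is an extended $\mathcal O$-operator with extension $\beta$ of mass $(\kappa,0)$ on $(A,\circ)$ associated to $(A^*,L_{A,\star}^*,-R_A^* )$.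
   Context: $\mathbf k$ is a field of characteristic zero; all vector spaces are finite-dimensional over $\mathbf k$. A Novikov algebra $(A,\circ)$ is a vector space with a bilinear operation satisfying $(a\circ b)\circ c-a\circ(b\circ c)=(b\circ a)\circ c-b\circ(a\circ c)$ and $(a\circ b)\circ c=(a\circ c)\circ b$ for all $a,b,c\in A$. Put $a\star b=a\circ b+b\circ a$, $L_A(a)b=a\circ b$, $R_A(a)b=b\circ a$, $L_{A,\star}=L_A+R_A$. For linear $\varphi:A\to\mathrm{End}_{\mathbf k}(V)$, define $\varphi^*:A\to\mathrm{End}_{\mathbf k}(V^* )$ by $\langle\varphi^*(a)f,v\rangle=-\langle f,\varphi(a)v\rangle$. Then $(A^*,L_{A,\star}^*,-R_A^* )$ is a bimodule of $(A,\circ)$, regarded with the zero product on $A^*$. Tensor notation: for $r=\sum_i x_i\otimes y_i$ and $r'=\sum_j x'_j\otimes y'_j$ in $A\otimes A$: $r_{13}\circ r'_{23}=\sum_{i,j}x_i\otimes x'_j\otimes y_i\circ y'_j$, $r_{12}\star r'_{23}=\sum_{i,j}x_i\otimes y_i\star x'_j\otimes y'_j$, $r_{13}\circ r'_{12}=\sum_{i,j}x_i\circ x'_j\otimes y'_j\otimes y_i$. $\tau(a\otimes b)=b\otimes a$. For $r\in A\otimes A$, the linear maps $\hat r,\hat r^t:A^*\to A$ are defined by $\langle\hat r(a^* ),b^*\rangle=\langle a^*\otimes b^*,r\rangle$ and $\langle a^*,\hat r^t(b^* )\rangle=\langle a^*\otimes b^*,r\rangle$. For a linear map $\gamma:A^*\to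 A$, $\check\gamma\in A\otimes A$ is the tensor with $\hat{\check\gamma}=\gamma$. A symmetric $s\in A\otimes A$ is invariant if $(L_A(x)\otimes\mathrm{id}+\mathrm{id}\otimes L_{A,\star}(x))s=0$ for all $x\in A$. Extended $\mathcal O$-operators associated to a bimodule $(V,l_A,r_A)$ of $(A,\circ)$ (with zero product on $V$, so the weight plays no role): a linear map $\alpha:V\to A$ is an extended $\mathcal O$-operator with extension $\beta:V\to A$ of mass $(\kappa,0)$ if $\beta$ is balanced, i.e. $l_A(\beta(u))v=r_A(\beta(v))u$; $\beta$ is $A$-invariant of mass $\kappa$, i.e. $\kappa(x\circ\beta(u))=\kappa\beta(l_A(x)u)$ and $\kappa(\beta(u)\circ x)=\kappa\beta(r_A(x)u)$; and $\alpha(u)\circ\alpha(v)-\alpha(l_A(\alpha(u))v+r_A(\alpha(v))u)=\kappa\,\beta(u)\circ\beta(v)$, for all $u,v\in V$, $x\in A$. *)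

(* Defs.v *)
From HB Require Import structures.
From mathcomp Require Import all_boot all_algebra ring.

Set Implicit Arguments.
Unset Strict Implicit.
Unset Printing Implicit Defensive.

Import GRing.Theory.
Local Open Scope ring_scope.

Reserved Notation "x ⊗ y" (at level 39, left associativity).
Reserved Notation "x ∘ y" (at level 38, left associativity).
Reserved Notation "x ⋆ y" (at level 38, left associativity).

(* The tensor product of two finite-dimensional spaces, in the coordinates of
   the bases [vbasis fullv] of the factors. The lemmas [tens_bilinear], [tliftE]
   and [tens_ext] are its universal property. *)
Definition tensor (k : fieldType) (U V : vectType k) : Type :=
  'M[k]_(\dim {:U}, \dim {:V}).

Definition tens (k : fieldType) (U V : vectType k) (u : U) (v : V) :
    tensor U V :=
  \matrix_(i, j) (coord (vbasis {:U}) i u * coord (vbasis {:V}) j v).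

Notation "x ⊗ y" := (tens x y) : ring_scope.

(* [tlift f] is the linear map on [tensor U V] induced by a bilinear [f]: it
   sends sum_i x_i ⊗ y_i to sum_i f x_i y_i, see [tlift_sum]. It is only
   meaningful for bilinear [f]. *)
Definition tlift (k : fieldType) (U V W : vectType k) (f : U -> V -> W)
    (r : tensor U V) : W :=
  \sum_i \sum_j (r : 'M_(_, _)) i j *: f (vbasis {:U})`_i (vbasis {:V})`_j.

Section TensorTheory.
Variables (k : fieldType) (U V W : vectType k).

Fact tlift_is_linear (f : U -> V -> W) : linear (tlift f).
Proof.
move=> a r s; rewrite /tlift scaler_sumr -big_split; apply: eq_bigr => i _ /=.
rewrite scaler_sumr -big_split; apply: eq_bigr => j _ /=.
by rewrite !mxE scalerDl scalerA.
Qed.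

HB.instance Definition _ (f : U -> V -> W) :=
  GRing.isLinear.Build k (tensor U V) W *:%R (tlift f) (tlift_is_linear f).

Lemma tens_bilinear : bilinear_for *:%R *:%R (@tens k U V).
Proof.
split=> [v a u u'|u a v v'] /=; apply/matrixP=> i j.
  by rewrite !mxE linearP /= mulrDl mulrA.
by rewrite !mxE linearP /= mulrDr mulrCA.
Qed.

HB.instance Definition _ :=
  bilinear_isBilinear.Build k U V (tensor U V) *:%R *:%R (@tens k U V)
    tens_bilinear.

Lemma tliftE (f : U -> V -> W) (u : U) (v : V) :
  bilinear_for *:%R *:%R f -> tlift f (u ⊗ v) = f u v.
Proof.
move=> [fl fr].
have suml n (c : 'I_n -> k) (w : 'I_n -> U) v' :
    f (\sum_i c i *: w i) v' = \sum_i c i *: f (w i) v'.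
  pose g := GRing.isLinear.Build _ _ _ _ _ (fl v').
  pose G : {linear U -> W} := HB.pack (f^~ v') g.
  by rewrite -[LHS]/(G _) linear_sum; apply: eq_bigr => i _; rewrite linearZ.
have sumr n (c : 'I_n -> k) (w : 'I_n -> V) u' :
    f u' (\sum_i c i *: w i) = \sum_i c i *: f u' (w i).
  pose g := GRing.isLinear.Build _ _ _ _ _ (fr u').
  pose G : {linear V -> W} := HB.pack (f u') g.
  by rewrite -[LHS]/(G _) linear_sum; apply: eq_bigr => i _; rewrite linearZ.
rewrite [in RHS](coord_vbasis (memvf u)) suml; apply: eq_bigr => i _.
rewrite [in RHS](coord_vbasis (memvf v)) sumr scaler_sumr.
by apply: eq_bigr => j _; rewrite mxE scalerA.
Qed.

Lemma tlift_sum (f : U -> V -> W) n (x : 'I_n -> U) (y : 'I_n -> V) :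
  bilinear_for *:%R *:%R f ->
  tlift f (\sum_i x i ⊗ y i) = \sum_i f (x i) (y i).
Proof.
by move=> fb; rewrite linear_sum; apply: eq_bigr => i _ /=; rewrite tliftE.
Qed.

Lemma tlift_tens (r : tensor U V) : tlift (@tens k U V) r = r.
Proof.
apply/matrixP=> i j; rewrite /tlift summxE (bigD1 i) //= summxE.
have freeb (T : vectType k) : free (vbasis {:T}).
  exact: basis_free (vbasisP _).
rewrite (bigD1 j) //= !mxE !coord_free // !eqxx !mulr1.
rewrite big1 ?addr0 => [|j' nj]; last first.
  rewrite !mxE !coord_free //.
  by have -> : (j' == j) = false := negPf nj; rewrite !mulr0.
rewrite big1 ?addr0 // => i' ni; rewrite summxE big1 // => j' _.
rewrite !mxE !coord_free //.
by have -> : (i' == i) = false := negPf ni; rewrite mul0r mulr0.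
Qed.

Lemma tens_ext (f g : {linear tensor U V -> W}) :
  (forall u v, f (u ⊗ v) = g (u ⊗ v)) -> f =1 g.
Proof.
move=> fg r; rewrite -(tlift_tens r) /tlift !linear_sum; apply: eq_bigr => i _.
by rewrite !linear_sum; apply: eq_bigr => j _; rewrite !linearZ /= fg.
Qed.

End TensorTheory.

Lemma tlift2_sum (k : fieldType) (U V U' V' W : vectType k)
    (F : U -> V -> U' -> V' -> W) m n (x : 'I_m -> U) (y : 'I_m -> V)
    (x' : 'I_n -> U') (y' : 'I_n -> V') :
  (forall u v, bilinear_for *:%R *:%R (F u v)) ->
  (forall u' v', bilinear_for *:%R *:%R (fun u v => F u v u' v')) ->
  tlift (fun u v => tlift (F u v) (\sum_j x' j ⊗ y' j)) (\sum_i x i ⊗ y i) =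
  \sum_i \sum_j F (x i) (y i) (x' j) (y' j).
Proof.
move=> Fin Fout; rewrite tlift_sum; last first.
  split=> [v c u w|u c v w] /=; rewrite /tlift scaler_sumr -big_split;
    apply: eq_bigr => i _ /=; rewrite scaler_sumr -big_split;
    apply: eq_bigr => j _ /=;
    first by rewrite (Fout _ _).1 scalerDr !scalerA mulrC.
  by rewrite (Fout _ _).2 scalerDr !scalerA mulrC.
by apply: eq_bigr => i _; rewrite tlift_sum.
Qed.

Definition tswap (k : fieldType) (U V : vectType k) : tensor U V -> tensor V U :=
  tlift (fun u v => v ⊗ u).

Definition tmap (k : fieldType) (U U' V V' : vectType k)
    (f : U -> U') (g : V -> V') : tensor U V -> tensor U' V' :=
  tlift (fun u v => f u ⊗ g v).

HB.instance Definition _ (k : fieldType) (U V : vectType k) :=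
  GRing.Linear.copy (@tswap k U V) (tlift (fun u v => v ⊗ u)).

HB.instance Definition _ (k : fieldType) (U U' V V' : vectType k)
    (f : U -> U') (g : V -> V') :=
  GRing.Linear.copy (tmap f g) (tlift (fun u v => f u ⊗ g v)).

HB.mixin Record Vector_isNovikov (k : fieldType) A of Vector k A := {
  nmul : A -> A -> A;
  nmul_bilinear : bilinear_for *:%R *:%R nmul;
  nmul_left_sym : forall a b c,
    nmul (nmul a b) c - nmul a (nmul b c) = nmul (nmul b a) c - nmul b (nmul a c);
  nmul_right_comm : forall a b c, nmul (nmul a b) c = nmul (nmul a c) b
}.

#[short(type="novikovType")]
HB.structure Definition Novikov (k : fieldType) :=
  {A of Vector k A & Vector_isNovikov k A}.

Notation "a ∘ b" := (nmul a b) : ring_scope.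

HB.instance Definition _ (k : fieldType) (A : novikovType k) :=
  bilinear_isBilinear.Build k A A A *:%R *:%R (@nmul k A) nmul_bilinear.

Definition nstar (k : fieldType) (A : novikovType k) (a b : A) : A :=
  a ∘ b + b ∘ a.

Notation "a ⋆ b" := (nstar a b) : ring_scope.

Fact nstar_bilinear (k : fieldType) (A : novikovType k) :
  bilinear_for *:%R *:%R (@nstar k A).
Proof.
by split=> [b c x y|a c x y]; rewrite /nstar linearPl linearPr /= scalerDr addrACA.
Qed.

HB.instance Definition _ (k : fieldType) (A : novikovType k) :=
  bilinear_isBilinear.Build k A A A *:%R *:%R (@nstar k A) (@nstar_bilinear k A).

Section Multiplications.
Variables (k : fieldType) (A : novikovType k).

Fact nmull_is_linear (b : A) : linear (fun a : A => a ∘ b).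
Proof. exact: (nmul_bilinear.1 b). Qed.

Fact nmulr_is_linear (a : A) : linear (fun b : A => a ∘ b).
Proof. exact: (nmul_bilinear.2 a). Qed.

Definition nleft (a : A) : 'End(A) := linfun (fun b => a ∘ b).
Definition nright (a : A) : 'End(A) := linfun (fun b => b ∘ a).

Lemma nleftE a b : nleft a b = a ∘ b.
Proof.
pose G : {linear A -> A} := HB.pack (fun b => a ∘ b)
  (GRing.isLinear.Build _ _ _ _ _ (nmulr_is_linear a)).
exact: (lfunE G).
Qed.

Lemma nrightE a b : nright a b = b ∘ a.
Proof.
pose G : {linear A -> A} := HB.pack (fun b => b ∘ a)
  (GRing.isLinear.Build _ _ _ _ _ (nmull_is_linear a)).
exact: (lfunE G).
Qed.

Fact nleft_is_linear : linear nleft.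
Proof.
move=> c a a'; apply/lfunP=> b.
by rewrite add_lfunE scale_lfunE !nleftE nmull_is_linear.
Qed.

Fact nright_is_linear : linear nright.
Proof.
move=> c a a'; apply/lfunP=> b.
by rewrite add_lfunE scale_lfunE !nrightE nmulr_is_linear.
Qed.

HB.instance Definition _ :=
  GRing.isLinear.Build k A 'End(A) *:%R nleft nleft_is_linear.
HB.instance Definition _ :=
  GRing.isLinear.Build k A 'End(A) *:%R nright nright_is_linear.

Definition nleft_star : A -> 'End(A) := nleft \+ nright.

HB.instance Definition _ := GRing.Linear.copy nleft_star (nleft \+ nright).

Lemma nleft_starE a b : nleft_star a b = a ⋆ b.
Proof. by rewrite add_lfunE nleftE nrightE. Qed.

End Multiplications.

Section DualAction.
Variables (k : fieldType) (A V : vectType k).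

Definition dual_map (g : 'End(V)) : 'End('Hom(V, k^o)) :=
  linfun (fun f : 'Hom(V, k^o) => - (f \o g)%VF).

Definition dual_act (phi : A -> 'End(V)) (a : A) : 'End('Hom(V, k^o)) :=
  dual_map (phi a).

Lemma dual_actE (phi : A -> 'End(V)) a (f : 'Hom(V, k^o)) v :
  dual_act phi a f v = - f (phi a v).
Proof.
have lin : linear (fun f : 'Hom(V, k^o) => - (f \o phi a)%VF).
  move=> c g h; apply/lfunP=> w.
  rewrite !(add_lfunE, opp_lfunE, scale_lfunE, comp_lfunE).
  by rewrite opprD scalerN.
pose G : {linear 'Hom(V, k^o) -> 'Hom(V, k^o)} :=
  HB.pack (fun f : 'Hom(V, k^o) => - (f \o phi a)%VF)
    (GRing.isLinear.Build _ _ _ _ _ lin).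
by rewrite /dual_act /dual_map (lfunE G) /= opp_lfunE comp_lfunE.
Qed.

Fact dual_act_is_linear (phi : {linear A -> 'End(V)}) : linear (dual_act phi).
Proof.
move=> c a b; apply/lfunP=> f; apply/lfunP=> v.
rewrite !(add_lfunE, scale_lfunE) !dual_actE linearP.
by rewrite add_lfunE scale_lfunE linearP opprD scalerN.
Qed.

HB.instance Definition _ (phi : {linear A -> 'End(V)}) :=
  GRing.isLinear.Build k A 'End('Hom(V, k^o)) *:%R (dual_act phi)
    (dual_act_is_linear phi).

End DualAction.

(* The four axioms say that A (+) V with product
   (a, u) ∘ (b, v) = (a ∘ b, lact a v + ract b u) is a Novikov algebra. *)
Record bimodule (k : fieldType) (A : novikovType k) (V : vectType k) := Bimodule {
  lact : {linear A -> 'End(V)};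
  ract : {linear A -> 'End(V)};
  lact_left_sym : forall a b v,
    lact (a ∘ b) v - lact a (lact b v) = lact (b ∘ a) v - lact b (lact a v);
  ract_left_sym : forall a b v,
    ract b (lact a v) - lact a (ract b v) = ract b (ract a v) - ract (a ∘ b) v;
  lact_right_comm : forall a b v, lact (a ∘ b) v = ract b (lact a v);
  ract_right_comm : forall a b v, ract b (ract a v) = ract a (ract b v)
}.

Section DualBimodule.
Variables (k : fieldType) (A : novikovType k).

Definition dual_lact : A -> 'End('Hom(A, k^o)) := dual_act (@nleft_star k A).
Definition dual_ract : A -> 'End('Hom(A, k^o)) :=
  \- (dual_act (@nright k A)).

HB.instance Definition _ :=
  GRing.Linear.copy dual_lact (dual_act (@nleft_star k A)).
HB.instance Definition _ :=
  GRing.Linear.copy dual_ract (\- (dual_act (@nright k A))).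

Lemma dual_lactE a (f : 'Hom(A, k^o)) x : dual_lact a f x = - f (a ⋆ x).
Proof. by rewrite dual_actE nleft_starE. Qed.

Lemma dual_ractE a (f : 'Hom(A, k^o)) x : dual_ract a f x = f (x ∘ a).
Proof. by rewrite opp_lfunE opp_lfunE dual_actE nrightE opprK. Qed.

Let subE (f g : 'Hom(A, k^o)) x : (f - g) x = f x - g x.
Proof. by rewrite add_lfunE opp_lfunE. Qed.

Let left_symE (f : 'Hom(A, k^o)) a b c :
  f (a ∘ (b ∘ c)) = f (a ∘ b ∘ c) - f (b ∘ a ∘ c) + f (b ∘ (a ∘ c)).
Proof.
have /(congr1 f) := nmul_left_sym a b c; rewrite !linearB /= => e.
by rewrite -addrA [- _ + _]addrC -opprB -e subKr.
Qed.

Let starE (f : 'Hom(A, k^o)) a b : f (a ⋆ b) = f (a ∘ b) + f (b ∘ a).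
Proof. exact: linearD. Qed.

Let star_rE (f : 'Hom(A, k^o)) a b c :
  f (a ∘ (b ⋆ c)) = f (a ∘ (b ∘ c)) + f (a ∘ (c ∘ b)).
Proof. by rewrite linearDr linearD. Qed.

Let star_lE (f : 'Hom(A, k^o)) a b c :
  f ((b ⋆ c) ∘ a) = f (b ∘ c ∘ a) + f (c ∘ b ∘ a).
Proof. by rewrite linearDl linearD. Qed.

Fact dual_lact_left_sym (a b : A) (f : 'Hom(A, k^o)) :
  dual_lact (a ∘ b) f - dual_lact a (dual_lact b f) =
  dual_lact (b ∘ a) f - dual_lact b (dual_lact a f).
Proof.
apply/lfunP=> x; rewrite !subE !dual_lactE !opprK.
rewrite !starE !(star_rE, star_lE) (left_symE f a b x) (left_symE f a x b).
rewrite (left_symE f b x a) (nmul_right_comm b x a) (nmul_right_comm a x b).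
rewrite (nmul_right_comm x b a); ring.
Qed.

Fact dual_ract_left_sym (a b : A) (f : 'Hom(A, k^o)) :
  dual_ract b (dual_lact a f) - dual_lact a (dual_ract b f) =
  dual_ract b (dual_ract a f) - dual_ract (a ∘ b) f.
Proof.
apply/lfunP=> x.
rewrite !subE !(dual_lactE, dual_ractE) opprK.
rewrite !starE !star_lE (left_symE f a x b) (nmul_right_comm x b a); ring.
Qed.

Fact dual_lact_right_comm (a b : A) (f : 'Hom(A, k^o)) :
  dual_lact (a ∘ b) f = dual_ract b (dual_lact a f).
Proof.
apply/lfunP=> x; rewrite !(dual_lactE, dual_ractE) !starE.
rewrite (left_symE f a x b) (nmul_right_comm a b x) (nmul_right_comm x b a).
ring.
Qed.

Fact dual_ract_right_comm (a b : A) (f : 'Hom(A, k^o)) :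
  dual_ract b (dual_ract a f) = dual_ract a (dual_ract b f).
Proof. by apply/lfunP=> x; rewrite !dual_ractE nmul_right_comm. Qed.

Definition dual_bimodule : bimodule A 'Hom(A, k^o) :=
  Bimodule dual_lact_left_sym dual_ract_left_sym dual_lact_right_comm
    dual_ract_right_comm.

End DualBimodule.

Section ExtendedOOperator.
Variables (k : fieldType) (A : novikovType k) (V : vectType k).
Variable M : bimodule A V.

Definition balanced (beta : 'Hom(V, A)) : Prop :=
  forall u v, lact M (beta u) v = ract M (beta v) u.

(* A-invariance of mass kappa. *)
Definition mod_invariant (kappa : k) (beta : 'Hom(V, A)) : Prop :=
  forall x u,
    kappa *: (x ∘ beta u) = kappa *: beta (lact M x u) /\
    kappa *: (beta u ∘ x) = kappa *: beta (ract M x u).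

(* The mass is (kappa, 0). *)
Definition extended_O_operator (kappa : k) (alpha beta : 'Hom(V, A)) : Prop :=
  [/\ balanced beta,
      mod_invariant kappa beta &
      forall u v,
        alpha u ∘ alpha v
          - alpha (lact M (alpha u) v + ract M (alpha v) u)
        = kappa *: (beta u ∘ beta v)].

End ExtendedOOperator.

Section TensorsAsMaps.
Variables (k : fieldType) (A : vectType k).
Implicit Types (r s : tensor A A) (a b : 'Hom(A, k^o)).

(* The pairing <a ⊗ b, r>. *)
Definition tpair a b r : k := tlift (fun x y => a x * b y : k^o) r.

(* [hatE] and [hat_tE] below are the defining identities of these two maps in
   terms of the pairing. *)
Definition hat r : 'Hom('Hom(A, k^o), A) :=
  linfun (fun a : 'Hom(A, k^o) => tlift (fun x y => a x *: y) r).

Definition hat_t r : 'Hom('Hom(A, k^o), A) :=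
  linfun (fun b : 'Hom(A, k^o) => tlift (fun x y => b y *: x) r).

Lemma hat_def r a : hat r a = tlift (fun x y => a x *: y) r.
Proof.
have lin : linear (fun a : 'Hom(A, k^o) => tlift (fun x y => a x *: y) r).
  move=> c f g; rewrite /tlift scaler_sumr -big_split; apply: eq_bigr => i _.
  rewrite scaler_sumr -big_split; apply: eq_bigr => j _ /=.
  rewrite add_lfunE scale_lfunE scalerDl scalerDr !scalerA; congr (_ *: _ + _).
  by rewrite mulrCA mulrA.
pose G : {linear 'Hom(A, k^o) -> A} := HB.pack
  (fun a : 'Hom(A, k^o) => tlift (fun x y => a x *: y) r)
  (GRing.isLinear.Build _ _ _ _ _ lin).
exact: (lfunE G).
Qed.

Lemma hat_t_def r b : hat_t r b = tlift (fun x y => b y *: x) r.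
Proof.
have lin : linear (fun b : 'Hom(A, k^o) => tlift (fun x y => b y *: x) r).
  move=> c f g; rewrite /tlift scaler_sumr -big_split; apply: eq_bigr => i _.
  rewrite scaler_sumr -big_split; apply: eq_bigr => j _ /=.
  rewrite add_lfunE scale_lfunE scalerDl scalerDr !scalerA; congr (_ *: _ + _).
  by rewrite mulrCA mulrA.
pose G : {linear 'Hom(A, k^o) -> A} := HB.pack
  (fun b : 'Hom(A, k^o) => tlift (fun x y => b y *: x) r)
  (GRing.isLinear.Build _ _ _ _ _ lin).
exact: (lfunE G).
Qed.

Lemma hatE r a b : b (hat r a) = tpair a b r.
Proof.
rewrite hat_def /tpair /tlift linear_sum; apply: eq_bigr => i _ /=.
by rewrite linear_sum; apply: eq_bigr => j _ /=; rewrite !linearZ /= linearZ.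
Qed.

Lemma hat_tE r a b : a (hat_t r b) = tpair a b r.
Proof.
rewrite hat_t_def /tpair /tlift linear_sum; apply: eq_bigr => i _ /=.
rewrite linear_sum; apply: eq_bigr => j _ /=.
by rewrite linearZ /= linearZ; congr (_ *: _); exact: mulrC.
Qed.

(* The basis of the dual space that is dual to [vbasis fullv]. *)
Definition coform (i : 'I_(\dim {:A})) : 'Hom(A, k^o) :=
  linfun (coord (vbasis {:A}) i : A -> k^o).

Definition check (gamma : 'Hom('Hom(A, k^o), A)) : tensor A A :=
  \sum_(i < \dim {:A}) (vbasis {:A})`_i ⊗ gamma (coform i).

Let coformE i x : coform i x = coord (vbasis {:A}) i x.
Proof. exact: (lfunE (coord (vbasis {:A}) i : {linear A -> k^o})). Qed.

Let coord_basis (i j : 'I_(\dim {:A})) :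
  coord (vbasis {:A}) j (vbasis {:A})`_i = (i == j)%:R.
Proof. exact/coord_free/basis_free/vbasisP. Qed.

Let coform_sum a : a = \sum_(i < \dim {:A}) a (vbasis {:A})`_i *: coform i.
Proof.
apply/lfunP=> x; rewrite sum_lfunE [in LHS](coord_vbasis (memvf x)) linear_sum.
apply: eq_bigr => i _; rewrite linearZ scale_lfunE coformE; exact: mulrC.
Qed.

Let scale_bilinear a : bilinear_for *:%R *:%R (fun x y : A => a x *: y).
Proof.
split=> [y c x x'|x c y y'] /=; first by rewrite linearP scalerDl scalerA.
by rewrite scalerDr !scalerA mulrC.
Qed.

Lemma checkK : cancel check hat.
Proof.
move=> gamma; apply/lfunP=> a; rewrite hat_def /check tlift_sum //.
by rewrite [in RHS](coform_sum a) linear_sum; apply: eq_bigr => i _; rewrite linearZ.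
Qed.

Lemma hatK : cancel hat check.
Proof.
move=> r; apply/matrixP=> i j; rewrite summxE (bigD1 i) //= mxE coord_basis eqxx.
rewrite big1 ?addr0 => [|i' ni]; last first.
  rewrite mxE coord_basis.
  by have -> : (i' == i) = false := negPf ni; rewrite mul0r.
rewrite mul1r -coformE hatE /tpair /tlift (bigD1 i) //= (bigD1 j) //=.
rewrite !coformE !coord_basis !eqxx mulr1.
rewrite big1 ?addr0 => [|j' nj]; last first.
  rewrite !coformE !coord_basis.
  by have -> : (j' == j) = false := negPf nj; rewrite mulr0 scaler0.
rewrite big1 ?addr0 => [|i' ni]; last first.
  rewrite big1 // => j' _; rewrite !coformE !coord_basis.
  by have -> : (i' == i) = false := negPf ni; rewrite mul0r scaler0.
exact: mulr1.
Qed.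

Lemma hat_swap r : hat (tswap r) = hat_t r.
Proof.
apply/lfunP=> a; rewrite hat_def hat_t_def /tswap {2}/tlift.
rewrite linear_sum; apply: eq_bigr => i _; rewrite linear_sum.
by apply: eq_bigr => j _; rewrite linearZ /= tliftE.
Qed.

End TensorsAsMaps.

Section NovikovYangBaxter.
Variables (k : fieldType) (A : novikovType k).
Implicit Types r s : tensor A A.

(* r_13 ∘ s_23, r_12 ⋆ s_23 and r_13 ∘ s_12; A ⊗ A ⊗ A is (A ⊗ A) ⊗ A. The
   formulas for sums of pure tensors are [o_13_23_sum], [star_12_23_sum] and
   [o_13_12_sum]. *)
Definition o_13_23 r s : tensor (tensor A A) A :=
  tlift (fun x y => tlift (fun x' y' => x ⊗ x' ⊗ (y ∘ y')) s) r.

Definition star_12_23 r s : tensor (tensor A A) A :=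
  tlift (fun x y => tlift (fun x' y' => x ⊗ (y ⋆ x') ⊗ y') s) r.

Definition o_13_12 r s : tensor (tensor A A) A :=
  tlift (fun x y => tlift (fun x' y' => (x ∘ x') ⊗ y' ⊗ y) s) r.

Section Sums.
Variables (m n : nat) (x y : 'I_m -> A) (x' y' : 'I_n -> A).
Let r := \sum_i x i ⊗ y i.
Let s := \sum_j x' j ⊗ y' j.

Lemma o_13_23_sum :
  o_13_23 r s = \sum_i \sum_j x i ⊗ x' j ⊗ (y i ∘ y' j).
Proof.
by apply: (tlift2_sum (F := fun a b c d => a ⊗ c ⊗ (b ∘ d))) => u v;
  split=> [w c a b|w c a b] /=; rewrite !(linearPl, linearPr).
Qed.

Lemma star_12_23_sum :
  star_12_23 r s = \sum_i \sum_j x i ⊗ (y i ⋆ x' j) ⊗ y' j.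
Proof.
by apply: (tlift2_sum (F := fun a b c d => a ⊗ (b ⋆ c) ⊗ d)) => u v;
  split=> [w c a b|w c a b] /=; rewrite !(linearPl, linearPr).
Qed.

Lemma o_13_12_sum :
  o_13_12 r s = \sum_i \sum_j (x i ∘ x' j) ⊗ y' j ⊗ y i.
Proof.
by apply: (tlift2_sum (F := fun a b c d => (a ∘ c) ⊗ d ⊗ b)) => u v;
  split=> [w c a b|w c a b] /=; rewrite !(linearPl, linearPr).
Qed.

End Sums.

Definition nyb r : tensor (tensor A A) A :=
  o_13_23 r r + star_12_23 r r + o_13_12 r r.

(* Used for symmetric [s] only. *)
Definition tensor_invariant s : Prop :=
  forall x : A, tmap (nleft x) idfun s + tmap idfun (nleft_star x) s = 0.

End NovikovYangBaxter.

(* Main.v *)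
Require Import Defs.
From HB Require Import structures.
From mathcomp Require Import all_boot all_algebra.

Set Implicit Arguments.
Unset Strict Implicit.
Unset Printing Implicit Defensive.

Import GRing.Theory.
Local Open Scope ring_scope.

(** Pairing the first two factors of A ⊗ A ⊗ A with a, b in the dual turns the
    three terms of the Yang-Baxter equation into r^(a) ∘ r^(b),
    - r^(L_⋆^*(r^(a)) b) and r^((-R)^*(r^t(b)) a), which gives (i). For (ii),
    invariance of the symmetric part says a(x ∘ β(b)) = - b(x ⋆ β(a)); as β is
    self-adjoint, this makes β balanced and A-invariant, so that after
    substituting r^ = α + β and r^t = β - α every mixed term cancels and only
    the O-operator defect of α plus β(a) ∘ β(b) is left. *)

(** * Contraction of the first two tensor factors with dual vectors *)

Section TensorContraction.
Variables (k : fieldType).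

(** Linearity of [g] is a plain hypothesis, so that unbundled maps such as [fun u => u ∘ z] can be
    moved inside a sum of pure tensors. *)
Lemma linear_tlift {U V W W' : vectType k} {g : W -> W'} {f : U -> V -> W}
    {r : tensor U V} :
  linear g -> g (tlift f r) = tlift (fun x y => g (f x y)) r.
Proof.
move=> g_lin; pose G : {linear W -> W'} := HB.pack g
  (GRing.isLinear.Build _ _ _ _ _ g_lin).
rewrite -[LHS]/(G _) linear_sum; apply: eq_bigr => i _.
by rewrite linear_sum; apply: eq_bigr => j _; rewrite linearZ.
Qed.

Lemma eq_tlift {U V W : vectType k} {f g : U -> V -> W} (r : tensor U V) :
  (forall x y, f x y = g x y) -> tlift f r = tlift g r.
Proof.
by move=> fg; apply: eq_bigr => i _; apply: eq_bigr => j _; rewrite fg.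
Qed.

Variable A : vectType k.
Implicit Types (a b : 'Hom(A, k^o)) (r s : tensor A A).

Lemma coformE (i : 'I_(\dim {:A})) x : coform i x = coord (vbasis {:A}) i x.
Proof. exact: (lfunE (coord (vbasis {:A}) i : {linear A -> k^o})). Qed.

Lemma dual_separates (x y : A) :
  (forall a, a x = a y) -> x = y.
Proof.
move=> axy; rewrite (coord_vbasis (memvf x)) (coord_vbasis (memvf y)).
by apply: eq_bigr => i _; rewrite -!coformE axy.
Qed.

Lemma mul_forms_bilinear a b :
  bilinear_for *:%R *:%R (fun x y : A => a x * b y : k^o).
Proof.
split=> [y c x x'|x c y y'] /=; rewrite linearP.
  by rewrite mulrDl -scalerAl.
by rewrite mulrDr -scalerAr.
Qed.

Lemma tpair_tens a b x y : tpair a b (x ⊗ y) = a x * b y.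
Proof. exact: tliftE (mul_forms_bilinear a b). Qed.

Lemma tpair_is_linear a b : linear (tpair a b : tensor A A -> k^o).
Proof. exact: tlift_is_linear. Qed.

Lemma tpair_coform r (i j : 'I_(\dim {:A})) :
  tpair (coform i) (coform j) r = (r : 'M_(_, _)) i j.
Proof.
have lin : linear (fun r : tensor A A => (r : 'M_(_, _)) i j : k^o).
  by move=> c s t; rewrite !mxE.
have := linear_tlift (f := @tens k A A) (r := r) lin; rewrite tlift_tens => ->.
by apply: (eq_tlift (W := k^o)) => x y; rewrite mxE !coformE.
Qed.

(** This is [a ⊗ b ⊗ id]; the third factor stays free, so that results lie in [A], where the
    operator identities live. *)
Definition contract12 a b : tensor (tensor A A) A -> A :=
  tlift (fun u z => tpair a b u *: z).

Lemma contract12_is_linear a b : linear (contract12 a b).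
Proof. exact: tlift_is_linear. Qed.

HB.instance Definition _ a b :=
  GRing.isLinear.Build k (tensor (tensor A A) A) A *:%R (contract12 a b)
    (contract12_is_linear a b).

Lemma contract12_tens2 a b u z : contract12 a b (u ⊗ z) = tpair a b u *: z.
Proof.
apply: tliftE; split=> [w c v v'|v c w w'] /=.
  by rewrite tpair_is_linear scalerDl scalerA.
by rewrite scalerDr !scalerA mulrC.
Qed.

Lemma contract12_tens a b x y z :
  contract12 a b (x ⊗ y ⊗ z) = (a x * b y) *: z.
Proof. by rewrite contract12_tens2 tpair_tens. Qed.

(** Both sides are linear in [t], so pure tensors [u ⊗ z] suffice; there the coefficients are the
    matrix entries of [u], by [tpair_coform]. *)
Lemma contract12_expand (t : tensor (tensor A A) A) :
  t = \sum_(i < \dim {:A}) \sum_(j < \dim {:A})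
    (vbasis {:A})`_i ⊗ (vbasis {:A})`_j ⊗ contract12 (coform i) (coform j) t.
Proof.
pose g (t : tensor (tensor A A) A) : tensor (tensor A A) A :=
  \sum_(i < \dim {:A}) \sum_(j < \dim {:A})
    (vbasis {:A})`_i ⊗ (vbasis {:A})`_j ⊗ contract12 (coform i) (coform j) t.
have lin : linear g.
  move=> c u v; rewrite /g scaler_sumr -big_split; apply: eq_bigr => i _ /=.
  rewrite scaler_sumr -big_split; apply: eq_bigr => j _ /=.
  by rewrite linearP linearPr.
pose G : {linear tensor (tensor A A) A -> tensor (tensor A A) A} :=
  HB.pack g (GRing.isLinear.Build _ _ _ _ _ lin).
rewrite -[RHS]/(G t); apply: (tens_ext (f := idfun)) => u z /=.
rewrite /g -{1}(tlift_tens u) /tlift linear_sumlz; apply: eq_bigr => i _.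
rewrite linear_sumlz; apply: eq_bigr => j _.
by rewrite linearZl_LR contract12_tens2 linearZr_LR tpair_coform.
Qed.

Lemma contract12_inj (t t' : tensor (tensor A A) A) :
  (forall a b, contract12 a b t = contract12 a b t') -> t = t'.
Proof.
move=> tt'; rewrite (contract12_expand t) (contract12_expand t').
by apply: eq_bigr => i _; apply: eq_bigr => j _; rewrite tt'.
Qed.

Lemma hatD r s : hat (r + s) = hat r + hat s.
Proof. by apply/lfunP=> a; rewrite add_lfunE !hat_def linearD. Qed.

Lemma hatZ (c : k) r : hat (c *: r) = c *: hat r.
Proof. by apply/lfunP=> a; rewrite scale_lfunE !hat_def linearZ. Qed.

Lemma hat_adjoint r a b : a (hat_t r b) = b (hat r a).
Proof. by rewrite hatE hat_tE. Qed.

Lemma tpair_tmap (f g : 'End(A)) a b r :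
  tpair a b (tmap f g r) = tpair (a \o f)%VF (b \o g)%VF r.
Proof.
rewrite /tmap (linear_tlift (g := tpair a b : _ -> k^o)); last first.
  exact: tpair_is_linear.
by apply: (eq_tlift (W := k^o)) => x y; rewrite tpair_tens !comp_lfunE.
Qed.

End TensorContraction.

(** * Contractions of the Yang-Baxter terms *)

Section YangBaxterContraction.
Variables (k : fieldType) (A : novikovType k).
Implicit Types (a b : 'Hom(A, k^o)) (r s : tensor A A).

(** The summand [(a x * b x') *: (y ∘ y')] splits as [(a x *: y) ∘ (b x' *: y')]. *)
Lemma contract_o_13_23 a b r s :
  contract12 a b (o_13_23 r s) = hat r a ∘ hat s b.
Proof.
rewrite /o_13_23 !hat_def (linear_tlift (contract12_is_linear a b)).
rewrite (linear_tlift (g := fun u => u ∘ _)); last exact: nmull_is_linear.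
apply: eq_tlift => x y; rewrite (linear_tlift (contract12_is_linear a b)).
rewrite linear_tlift; last exact: nmulr_is_linear.
apply: eq_tlift => x' y'.
by rewrite contract12_tens linearZl_LR /= linearZr_LR /= scalerA.
Qed.

Lemma dual_lactP c (x y : A) :
  dual_lact (c *: x + y) = c *: dual_lact x + dual_lact y.
Proof. exact: (dual_act_is_linear (@nleft_star k A)). Qed.

Lemma dual_lactD (x y : A) : dual_lact (x + y) = dual_lact x + dual_lact y.
Proof. by have := dual_lactP 1 x y; rewrite !scale1r. Qed.

Lemma dual_lactZ c (x : A) : dual_lact (c *: x) = c *: dual_lact x.
Proof.
apply/lfunP=> f; apply/lfunP=> v; rewrite !scale_lfunE !dual_lactE.
by rewrite linearZl_LR linearZ scalerN.
Qed.

Lemma dual_ractB (x y : A) : dual_ract (x - y) = dual_ract x - dual_ract y.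
Proof.
have subE (g h : 'End('Hom(A, k^o))) f v : (g - h) f v = g f v - h f v.
  by rewrite !(add_lfunE, opp_lfunE).
apply/lfunP=> f; apply/lfunP=> v; rewrite subE !dual_ractE.
by rewrite linearBr linearB.
Qed.

(** A summand becomes [(a x * b (y ⋆ x')) *: y']; the minus sign comes from
    [b (y ⋆ x') = - dual_lact y b x']. *)
Lemma contract_star_12_23 a b r s :
  contract12 a b (star_12_23 r s) = - hat s (dual_lact (hat r a) b).
Proof.
have lin : linear (fun y => - hat s (dual_lact y b)).
  move=> c y y'; rewrite dual_lactP add_lfunE scale_lfunE linearD opprD.
  by rewrite linearZ scalerN.
rewrite /star_12_23 [hat r a]hat_def (linear_tlift lin).
rewrite (linear_tlift (contract12_is_linear a b)).
apply: eq_tlift => x y; rewrite (linear_tlift (contract12_is_linear a b)).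
have lin' : linear (fun z : A => - ((a x : k) *: z)).
  by move=> c z z'; rewrite scalerDr opprD scalerN !scalerA mulrC.
rewrite dual_lactZ scale_lfunE linearZ /= hat_def (linear_tlift lin').
apply: eq_tlift => x' y'.
by rewrite contract12_tens dual_lactE scaleNr scalerN opprK scalerA.
Qed.

(** Here [b] meets the second leg of [s], and summing [b y' *: x'] gives [hat_t s b]; this is how
    the transpose enters. *)
Lemma contract_o_13_12 a b r s :
  contract12 a b (o_13_12 r s) = hat r (dual_ract (hat_t s b) a).
Proof.
rewrite /o_13_12 [RHS]hat_def (linear_tlift (contract12_is_linear a b)).
apply: eq_tlift => x y; rewrite (linear_tlift (contract12_is_linear a b)).
have lin : linear (fun z : A => (a (x ∘ z) : k) *: y).
  by move=> c z z'; rewrite nmulr_is_linear linearP scalerDl scalerA.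
rewrite dual_ractE hat_t_def (linear_tlift lin).
apply: eq_tlift => x' y'.
by rewrite contract12_tens linearZr_LR linearZ mulrC.
Qed.

Lemma contract_nyb a b r :
  contract12 a b (nyb r) =
  hat r a ∘ hat r b
    - hat r (dual_lact (hat r a) b - dual_ract (hat_t r b) a).
Proof.
have contractD t t' :
    contract12 a b (t + t') = contract12 a b t + contract12 a b t'.
  exact: linearD.
rewrite !contractD contract_o_13_23 contract_star_12_23 contract_o_13_12.
move: (dual_lact _ _) (dual_ract _ _) => f g.
by rewrite linearB opprB addrAC addrA.
Qed.

(** Reconciles the form $(-R_A)^*$ in (i) with the form $-R_A^*$ in the bimodule. *)
Lemma dual_act_opp_nright x a :
  dual_act (fun y : A => - nright y) x a = dual_ract x a.
Proof.
apply/lfunP=> y.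
by rewrite dual_actE dual_ractE opp_lfunE linearN opprK nrightE.
Qed.

End YangBaxterContraction.

(** * Consequences of invariance for a symmetric tensor *)

Section InvariantSymmetricTensor.
Variables (k : fieldType) (A : novikovType k) (s : tensor A A).
Hypotheses (s_sym : hat_t s = hat s) (s_inv : tensor_invariant s).
Implicit Types a b : 'Hom(A, k^o).

Lemma symmetric_adjoint a b : a (hat s b) = b (hat s a).
Proof. by rewrite -{1}s_sym hat_adjoint. Qed.

Lemma invariant_pairing a b x : a (x ∘ hat s b) = - b (x ⋆ hat s a).
Proof.
(* [tpair_tmap] expects elements of ['End(A)], so [idfun] is first replaced by [\1%VF]. *)
have tmap_id : tmap idfun (nleft_star x) s = tmap \1%VF (nleft_star x) s.
  by apply: eq_tlift => u v; rewrite id_lfunE.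
have tmap_id' : tmap (nleft x) idfun s = tmap (nleft x) \1%VF s.
  by apply: eq_tlift => u v; rewrite id_lfunE.
have := congr1 (tpair a b) (s_inv x).
have tpairD t t' : tpair a b (t + t') = tpair a b t + tpair a b t'.
  by have := tpair_is_linear a b 1 t t'; rewrite !scale1r.
have -> : tpair a b 0 = 0.
  by apply: (addrI (tpair a b 0)); rewrite -tpairD !addr0.
rewrite tmap_id tmap_id' tpairD !tpair_tmap.
rewrite !comp_lfun1r -hat_tE -hatE !comp_lfunE nleftE nleft_starE s_sym.
by move/eqP; rewrite addr_eq0 => /eqP.
Qed.

(** Evaluated at [x], this is [invariant_pairing] up to commutativity of [⋆]. *)
Lemma invariant_balanced : balanced (dual_bimodule A) (hat s).
Proof.
move=> a b; apply/lfunP=> x; rewrite dual_lactE dual_ractE invariant_pairing.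
by rewrite /nstar addrC.
Qed.

Lemma invariant_lact x b : x ∘ hat s b = hat s (dual_lact x b).
Proof.
apply: dual_separates => a; rewrite symmetric_adjoint dual_lactE.
exact: invariant_pairing.
Qed.

(** After pairing with [a], the two sides are [a (hat s b ∘ x)] and [b (hat s a ∘ x)]. By
    [invariant_pairing], used in both orders, each is the negative of
    [b (x ∘ hat s a) + a (x ∘ hat s b)]. *)
Lemma invariant_ract x b : hat s b ∘ x = hat s (dual_ract x b).
Proof.
apply: dual_separates => a; rewrite symmetric_adjoint dual_ractE.
have starE (f : 'Hom(A, k^o)) y z : f (y ⋆ z) = f (y ∘ z) + f (z ∘ y).
  exact: linearD.
have := invariant_pairing a b x; have := invariant_pairing b a x.
rewrite !starE => bx ax.
apply: (addrI (b (x ∘ hat s a) + a (x ∘ hat s b))).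
by rewrite -[LHS]addrA {1}bx addNr addrAC ax subrr.
Qed.

Lemma invariant_mod_invariant kappa :
  mod_invariant (dual_bimodule A) kappa (hat s).
Proof. by move=> x u; rewrite invariant_lact invariant_ract. Qed.

Lemma contract_nyb_skew a b r (alpha : 'Hom('Hom(A, k^o), A)) :
  hat r = alpha + hat s -> hat_t r = hat s - alpha ->
  contract12 a b (nyb r) =
  alpha a ∘ alpha b
    - alpha (dual_lact (alpha a) b + dual_ract (alpha b) a)
    + hat s a ∘ hat s b.
Proof.
move=> rE rtE.
have rV f : hat r f = alpha f + hat s f by rewrite rE add_lfunE.
have rtV f : hat_t r f = hat s f - alpha f.
  by rewrite rtE add_lfunE opp_lfunE.
have addE (g h : 'End('Hom(A, k^o))) f : (g + h) f = g f + h f.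
  by rewrite add_lfunE.
have subE (g h : 'End('Hom(A, k^o))) f : (g - h) f = g f - h f.
  by rewrite add_lfunE opp_lfunE.
rewrite contract_nyb !rV rtV dual_lactD dual_ractB addE subE.
(* Balancedness makes the two [hat s] contributions inside the argument of [hat r] cancel. *)
have -> : dual_lact (hat s a) b = dual_ract (hat s b) a.
  exact: invariant_balanced.
have cancelX (L X P : 'Hom(A, k^o)) : L + X - (X - P) = L + P.
  by rewrite opprB [P - X]addrC addrA addrK.
(* By invariance, [hat s] sends the remaining functional to [alpha a ∘ hat s b + hat s a ∘ alpha b],
   the mixed terms of the expanded product. *)
rewrite cancelX [hat s (_ + _)]linearD /= -invariant_lact -invariant_ract.
rewrite linearDl !linearDr /= [hat s a ∘ _ + _]addrC addrACA opprD.
by rewrite [LHS]addrACA subrr addr0 addrAC.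
Qed.

End InvariantSymmetricTensor.

Theorem theorem3p5 (k : fieldType) (k_char0 : [pchar k] =i pred0)
    (A : novikovType k) (r : tensor A A) :
  (nyb r = 0 <->
   forall a b : 'Hom(A, k^o),
     hat r a ∘ hat r b =
     hat r (dual_act (@nleft_star k A) (hat r a) b
            - dual_act (fun x : A => - nright x) (hat_t r b) a))
  /\
  (forall kappa : k,
   let alpha := 2^-1 *: (hat r - hat_t r) in
   let beta := 2^-1 *: (hat r + hat_t r) in
   [/\ hat r = alpha + beta,
       check beta = 2^-1 *: (r + tswap r) &
       tensor_invariant (check beta) ->
       (nyb r = ((kappa + 1) / 4) *: o_13_23 (r + tswap r) (r + tswap r) <->
        extended_O_operator (dual_bimodule A) kappa alpha beta)]).
Proof.
have two0 : 2 != 0 :> k by move/pcharf0P: k_char0 => ->.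
split=> [|kappa alpha beta].
  split=> [nyb0 a b|eq0].
    apply/eqP; rewrite dual_act_opp_nright -subr_eq0 -contract_nyb nyb0.
    by rewrite linear0.
  apply: contract12_inj => a b; rewrite linear0 contract_nyb eq0.
  by rewrite dual_act_opp_nright subrr.
have halve (V : lmodType k) (u : V) : 2^-1 *: (u + u) = u.
  by rewrite -mulr2n -scaler_nat scalerA mulVf // scale1r.
have skew_add (V : lmodType k) (u v : V) :
    u = 2^-1 *: (u - v) + 2^-1 *: (u + v).
  by rewrite -scalerDr addrACA addNr addr0 halve.
have sym_sub (V : lmodType k) (u v : V) :
    v = 2^-1 *: (u + v) - 2^-1 *: (u - v).
  by rewrite -scalerBr opprB addrC addrA subrK halve.
have rE : hat r = alpha + beta by exact: skew_add.
have rtE : hat_t r = beta - alpha by exact: sym_sub.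
have betaE : check beta = 2^-1 *: (r + tswap r).
  by apply: (can_inj (@hatK k A)); rewrite checkK hatZ hatD hat_swap.
split=> // inv.
(* [beta] is self-adjoint, being half the sum of two mutually adjoint maps. *)
have s_sym : hat_t (check beta) = hat (check beta).
  apply/lfunP=> b; apply: dual_separates => a; rewrite hat_adjoint checkK.
  rewrite !scale_lfunE !linearZ !add_lfunE !linearD /= !hat_adjoint.
  by rewrite -(hat_adjoint r b a) addrC.
have hat2 : hat (r + tswap r) = 2 *: beta.
  by rewrite scalerA mulfV // scale1r hatD hat_swap.
(* Each factor contributes [2 *: beta], which accounts for the denominator 4. *)
have rhsE a b :
  contract12 a b
    (((kappa + 1) / 4) *: o_13_23 (r + tswap r) (r + tswap r)) =
  (kappa + 1) *: (beta a ∘ beta b).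
  rewrite linearZ /= contract_o_13_23 hat2 !scale_lfunE.
  rewrite linearZl_LR /= linearZr_LR /=.
  by rewrite !scalerA -!mulrA -natrM mulVf ?mulr1 // (natrM _ 2 2) mulf_neq0.
have lhsE a b : contract12 a b (nyb r) =
    alpha a ∘ alpha b
      - alpha (dual_lact (alpha a) b + dual_ract (alpha b) a)
      + beta a ∘ beta b.
  by have := contract_nyb_skew (alpha := alpha) s_sym inv a b;
     rewrite checkK => ->.
(* One copy of [beta a ∘ beta b] stands on the left and [kappa + 1] on the right; removing one from
   each leaves the mass [kappa]. *)
split=> [nybE|[_ _ alphaO]].
  have bal := invariant_balanced s_sym inv.
  have mod := invariant_mod_invariant s_sym inv kappa.
  rewrite checkK in bal mod; split=> // a b.
  apply: (addIr (beta a ∘ beta b)); rewrite -lhsE nybE rhsE.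
  by rewrite scalerDl scale1r.
apply: contract12_inj => a b; rewrite lhsE rhsE scalerDl scale1r.
by congr (_ + _); exact: alphaO.
Qed.
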